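(* Let $(X,d)$ be a nonempty metric space with finite distance set $D=d(X\times X)$, and suppose there exists $r\in D$ such that the threshold relation $R_r^X$ is connected over $X$ and separating over $X$. Suppose that $(X,d)\cong A_1^{m_1}\times_\infty\cdots\times_\infty A_s^{m_s}$, where $s\geq1$, $A_1,\dots,A_s$ are pairwise nonisometric $\ell^\infty$-prime metric spaces, and $m_i\geq1$ for every $i$. Let $k\geq2$ be an integer with $k\mid m_i$ for every $1\leq i\leq s$, and let $\sqrt[k]{X}$ be a metric space representing the isometry class of $A_1^{m_1/k}\times_\infty\cdots\times_\infty A_s^{m_s/k}$. Fix an isometry $\phi_0:\Delta_k(\sqrt[k]{X})\to X$, and define $$H_{\phi_0,k}:=\{\phi_0\circ f^{\times k}\circ\phi_0^{-1}:f\in\operatorname{Iso}(\sqrt[k]{X})\}.$$ Then the map $g\mapsto\mathcal F_k(\sqrt[k]{X},g\circ\phi_0)$, $g\in\operatorname{Iso}(X)$, induces a bijection $$\operatorname{Iso}(X)/H_{\phi_0,k}\cong\operatorname{Ob}(\mathbf{PowStr}_k(X)),$$ where $\operatorname{Iso}(X)/H_{\phi_0,k}=\{gH_{\phi_0,k}:g\in\operatorname{Iso}(X)\}$.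
   Context: All metric spaces are nonempty and all isometries are bijective; $\cong$ between metric spaces means isometric; $\operatorname{Iso}(X)$ is the group of isometries $X\to X$. Finite products $\times_\infty$ and powers carry the max product metric $\max_jd_j(p_j,q_j)$; $\Delta_k(P)$ is $P^k$ with this metric; $\pi_j:P^k\to P$ is the $j$-th projection; $f^{\times k}$ is the coordinatewise map. A metric space $X$ is $\ell^\infty$-prime if $|X|>1$ and every isometry $X\cong Y\times_\infty Z$ forces $|Y|=1$ or $|Z|=1$. For $r\geq0$, $R_r^X(x,y)\iff d(x,y)\leq r$. $R_r^X$ is connected over $X$ if for all distinct $x,y\in X$ there is a finite sequence $x=x_0,\dots,x_n=y$ with $R_r^X(x_i,x_{i+1})$ for all $0\le i<n$; it is separating over $X$ if for all distinct $x,y\in X$ there is $z\in X$ such that exactly one of $R_r^X(z,x)$, $R_r^X(z,y)$ holds. For an equivalence relation $E$ on $X$, $\bar d_E([x]_E,[y]_E):=\inf\{d(x',y'):x'Ex,\ y'Ey\}$. $\mathbf{PowStr}_k(X)$ is the discrete category of ordered $k$-power structures on $(X,d)$: tuples $(E_1,\dots,E_k,\tau_2,\dots,\tau_k)$ with $E_j$ equivalence relations on $X$ and $\tau_j:X/E_j\to X/E_1$ maps such that each $\bar d_{E_j}$ is a metric on $X/E_j$; for all classes $C_j\in X/E_j$ ($1\le j\le k$), $\bigcap_{j=1}^kC_j$ is exactly one point; $d(x,y)=\max_{1\le j\le k}\bar d_{E_j}([x]_{E_j},[y]_{E_j})$ for all $x,y$; and each $\tau_j:(X/E_j,\bar d_{E_j})\to(X/E_1,\bar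 d_{E_1})$ is an isometry. For a metric space $P$ and an isometry $\phi:\Delta_k(P)\to X$, $\mathcal F_k(P,\phi):=(E_1^\phi,\dots,E_k^\phi,\tau_2^\phi,\dots,\tau_k^\phi)$, where $q_j^\phi:=\pi_j\circ\phi^{-1}$, $xE_j^\phi y\iff q_j^\phi(x)=q_j^\phi(y)$, $\bar q_j^\phi:X/E_j^\phi\to P$ is the induced map, and $\tau_j^\phi:=(\bar q_1^\phi)^{-1}\circ\bar q_j^\phi$. *)

(* Defs.v *)
From HB Require Import structures.
From mathcomp Require Import all_boot all_order all_algebra.
From mathcomp Require Import generic_quotient.
From mathcomp Require Import boolp classical_sets cardinality reals.
From mathcomp Require Import topology.

Set Warnings "-redundant-canonical-projection".
Set Implicit Arguments.
Unset Strict Implicit.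
Unset Printing Implicit Defensive.

Import Order.TTheory GRing.Theory Num.Theory.

Local Open Scope classical_set_scope.
Local Open Scope ring_scope.
Local Open Scope quotient_scope.

Lemma bij_inv_subproof (S T : Type) (f : S -> T) :
  bijective f -> exists g : T -> S, cancel f g /\ cancel g f.
Proof. by case=> g fK gK; exists g. Qed.

Definition bij_inv (S T : Type) (f : S -> T) (hf : bijective f) : T -> S :=
  sval (cid (bij_inv_subproof hf)).

Lemma bij_invK (S T : Type) (f : S -> T) (hf : bijective f) :
  cancel f (bij_inv hf).
Proof. by rewrite /bij_inv; case: cid => g []. Qed.

Lemma bij_invKV (S T : Type) (f : S -> T) (hf : bijective f) :
  cancel (bij_inv hf) f.
Proof. by rewrite /bij_inv; case: cid => g []. Qed.

Section RawMetrics.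
Variable R : realType.

Definition is_metric (T : Type) (d : T -> T -> R) : Prop :=
  [/\ forall x y, 0 <= d x y,
      forall x y, d x y = 0 <-> x = y,
      forall x y, d x y = d y x &
      forall x y z, d x z <= d x y + d y z].

Definition is_isometry (S T : Type) (dS : S -> S -> R) (dT : T -> T -> R)
  (f : S -> T) : Prop :=
  bijective f /\ forall x y, dT (f x) (f y) = dS x y.

End RawMetrics.

Section Isometries.
Variable R : realType.
Implicit Types X Y Z : metricType R.

Record metric_iso X Y := MetricIso {
  iso_fun :> X -> Y;
  isoP : is_isometry mdist mdist iso_fun }.

Definition isometric X Y : Prop := inhabited (metric_iso X Y).

Definition iso_inv_fun X Y (f : metric_iso X Y) : Y -> X :=
  bij_inv (proj1 (isoP f)).

Lemma iso_inv_subproof X Y (f : metric_iso X Y) :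
  is_isometry mdist mdist (iso_inv_fun f).
Proof.
split.
  by exists f; [exact: bij_invKV | exact: bij_invK].
by move=> x y; rewrite -(proj2 (isoP f)) !bij_invKV.
Qed.

Definition iso_inv X Y (f : metric_iso X Y) : metric_iso Y X :=
  MetricIso (iso_inv_subproof f).

Lemma iso_comp_subproof X Y Z (g : metric_iso Y Z) (f : metric_iso X Y) :
  is_isometry mdist mdist (g \o f).
Proof.
split; first exact: bij_comp (proj1 (isoP g)) (proj1 (isoP f)).
by move=> x y /=; rewrite (proj2 (isoP g)) (proj2 (isoP f)).
Qed.

Definition iso_comp X Y Z (g : metric_iso Y Z) (f : metric_iso X Y) :
  metric_iso X Z := MetricIso (iso_comp_subproof g f).

End Isometries.

Section BinaryProduct.
Variables (R : realType) (Y Z : metricType R).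

(* The library already equips [Y * Z] with the product pseudometric, whose
   balls are products of balls; this is the matching distance. *)
Let pair_dist (p q : Y * Z) : R := Num.max (mdist p.1 q.1) (mdist p.2 q.2).

Let pair_dist_ge0 p q : 0 <= pair_dist p q.
Proof. by rewrite le_max mdist_ge0. Qed.

Let pair_dist_positivity p q : pair_dist p q = 0 -> p = q.
Proof.
case: p q => [y z] [y' z'] /= h.
have /andP[hy hz] : (mdist y y' <= 0) && (mdist z z' <= 0).
  by rewrite -ge_max -[in leRHS]h.
congr pair; apply: mdist_positivity; apply: le_anti.
  by rewrite hy mdist_ge0.
by rewrite hz mdist_ge0.
Qed.

Let ball_pair_dist p e : ball p e = [set q | pair_dist p q < e].
Proof.
apply/seteqP; split => q /=; rewrite /pair_dist gt_max.
  by case; rewrite !ballEmdist /= => -> ->.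
by case/andP=> h1 h2; split; rewrite ballEmdist.
Qed.

HB.instance Definition _ :=
  @PseudoMetric_isMetric.Build R (Y * Z)%type pair_dist
    pair_dist_ge0 pair_dist_positivity ball_pair_dist.

End BinaryProduct.

Definition linf_prod (R : realType) (I : finType) (P : I -> metricType R) :
  Type := forall i, P i.

Section FiniteProduct.
Variables (R : realType) (I : finType) (P : I -> metricType R).

HB.instance Definition _ := gen_eqMixin (linf_prod P).
HB.instance Definition _ := gen_choiceMixin (linf_prod P).

(* Distances are nonnegative, so the seed 0 only matters for the empty
   product. *)
Definition linf_dist (p q : linf_prod P) : R :=
  \big[Num.max/0]_(i : I) mdist (p i) (q i).

Lemma linf_dist_le (p q : linf_prod P) (a : R) : 0 <= a ->
  (linf_dist p q <= a) <-> (forall i, mdist (p i) (q i) <= a).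
Proof.
move=> a0; split => [h i|h].
  by apply: le_trans h; rewrite /linf_dist (bigD1 i)//= le_max lexx.
by rewrite /linf_dist; elim/big_ind: _ => // x y xa ya; rewrite ge_max xa ya.
Qed.

Lemma linf_dist_ge0 p q : 0 <= linf_dist p q.
Proof.
rewrite /linf_dist; elim/big_ind: _ => //; last by move=> *; exact: mdist_ge0.
by move=> x y x0 y0; rewrite le_max x0.
Qed.

Let linf_distxx p : linf_dist p p = 0.
Proof.
apply: le_anti; rewrite linf_dist_ge0 andbT.
by apply/linf_dist_le => // i; rewrite mdistxx.
Qed.

Let linf_dist_positivity p q : linf_dist p q = 0 -> p = q.
Proof.
move=> h; apply: functional_extensionality_dep => i.
apply: mdist_positivity; apply: le_anti; rewrite mdist_ge0 andbT.
by move: i; apply/linf_dist_le => //; rewrite h.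
Qed.

Let linf_dist_sym p q : linf_dist p q = linf_dist q p.
Proof. by apply: eq_bigr => i _; rewrite metric_sym. Qed.

Let linf_dist_triangle q p s :
  linf_dist p s <= linf_dist p q + linf_dist q s.
Proof.
apply/linf_dist_le => [|i]; first by rewrite addr_ge0// linf_dist_ge0.
apply: (le_trans (metric_triangle _ (q i) _)).
by apply: lerD; move: i; apply/linf_dist_le; rewrite ?linf_dist_ge0.
Qed.

HB.instance Definition _ := @isMetric.Build R (linf_prod P) linf_dist
  linf_distxx linf_dist_positivity linf_dist_sym linf_dist_triangle.

End FiniteProduct.

(* The space written Delta_k(P), and also the power factors A_i^{m_i}. *)
Definition linf_pow (R : realType) (P : metricType R) (k : nat) :
  metricType R := linf_prod (fun _ : 'I_k => P).

Section Powers.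
Variables (R : realType) (k : nat).
Implicit Types P : metricType R.

Definition pow_proj P (j : 'I_k) (p : linf_pow P k) : P := p j.

Definition pow_map P (f : P -> P) (p : linf_pow P k) : linf_pow P k :=
  fun j => f (p j).

Lemma pow_map_subproof P (f : metric_iso P P) :
  is_isometry mdist mdist (pow_map f).
Proof.
split; last by move=> p q; apply: eq_bigr => j _; exact: (proj2 (isoP f)).
exists (pow_map (iso_inv f)) => p; apply: functional_extensionality_dep => j.
  exact: bij_invK.
exact: bij_invKV.
Qed.

Definition pow_iso P (f : metric_iso P P) :
  metric_iso (linf_pow P k) (linf_pow P k) := MetricIso (pow_map_subproof f).

End Powers.

Definition one_point (T : Type) : Prop := exists y : T, [set: T] = [set y].

Definition linf_prime (R : realType) (X : metricType R) : Prop :=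
  (exists x y : X, x <> y) /\
  forall Y Z : metricType R,
    isometric X (Y * Z)%type -> one_point Y \/ one_point Z.

Section Thresholds.
Variables (R : realType) (X : metricType R).

Definition distance_set : set R := [set mdist p.1 p.2 | p in [set: X * X]].

Definition threshold (r : R) : rel X := fun x y => mdist x y <= r.

Definition connected_over (e : rel X) : Prop :=
  forall x y : X, x <> y -> exists2 s : seq X, path e x s & last x s = y.

Definition separating_over (e : rel X) : Prop :=
  forall x y : X, x <> y -> exists z : X, e z x (+) e z y.

End Thresholds.

Section PowerStructures.
Variables (R : realType) (X : metricType R).

Definition quot_fiber (E : equiv_rel X) (C : {eq_quot E}) : set X :=
  [set x | \pi_{eq_quot E} x = C].

Definition quot_dist (E : equiv_rel X) (C C' : {eq_quot E}) : R :=
  inf [set mdist x y | x in quot_fiber C & y in quot_fiber C'].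

Variables (k : nat) (hk : (1 < k)%N).

Definition ord_first : 'I_k := Ordinal (ltnW hk).

(* The indices 1, ..., k are the elements 0, ..., k-1 of ['I_k]; [pow_tau] is
   therefore only given at the indices distinct from the first one. *)
Record pow_data := PowData {
  pow_rel : 'I_k -> equiv_rel X;
  pow_tau : forall j : 'I_k, (0 < j)%N ->
    {eq_quot (pow_rel j)} -> {eq_quot (pow_rel ord_first)} }.

Definition is_pow_str (S : pow_data) : Prop :=
  [/\ forall j, is_metric (@quot_dist (pow_rel S j)),
      forall C : (forall j, {eq_quot (pow_rel S j)}),
        exists x : X, \bigcap_j quot_fiber (C j) = [set x],
      forall x y : X,
        mdist x y =
        \big[Num.max/0]_(j < k) quot_dist (\pi_{eq_quot (pow_rel S j)} x)
                                          (\pi_{eq_quot (pow_rel S j)} y) &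
      forall (j : 'I_k) (hj : (0 < j)%N),
        is_isometry (@quot_dist (pow_rel S j))
                    (@quot_dist (pow_rel S ord_first))
                    (@pow_tau S j hj)].

Definition PowStr : Type := {S : pow_data | is_pow_str S}.

Variables (P : metricType R) (phi : metric_iso (linf_pow P k) X).

Definition coord (j : 'I_k) (x : X) : P := pow_proj j (iso_inv phi x).

Definition coord_rel (j : 'I_k) : rel X := fun x y => coord j x == coord j y.

Lemma coord_rel_refl j : reflexive (coord_rel j).
Proof. by move=> x; exact: eqxx. Qed.

Lemma coord_rel_sym j : symmetric (coord_rel j).
Proof. by move=> x y; exact: eq_sym. Qed.

Lemma coord_rel_trans j : transitive (coord_rel j).
Proof. by move=> y x z /eqP h /eqP h'; apply/eqP; rewrite h h'. Qed.

Definition coord_equiv (j : 'I_k) : equiv_rel X :=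
  EquivRel (coord_rel j) (@coord_rel_refl j) (@coord_rel_sym j)
    (@coord_rel_trans j).

Definition coord_bar (j : 'I_k) (C : {eq_quot (coord_equiv j)}) : P :=
  coord j (repr C).

Lemma coord_bar_pi j (x : X) :
  coord_bar (\pi_{eq_quot (coord_equiv j)} x) = coord j x.
Proof.
have /eqP : \pi_{eq_quot (coord_equiv j)} (repr (\pi_{eq_quot (coord_equiv j)} x))
  = \pi_{eq_quot (coord_equiv j)} x by rewrite reprK.
by rewrite eqmodE => /eqP.
Qed.

Lemma coord_bar_bij j : bijective (@coord_bar j).
Proof.
exists (fun p => \pi_{eq_quot (coord_equiv j)} (phi (fun=> p))) => [C|p].
  rewrite -[RHS]reprK; apply/eqP; rewrite eqmodE; apply/eqP.
  by rewrite /coord /pow_proj /= /iso_inv_fun bij_invK.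
by rewrite coord_bar_pi /coord /pow_proj /= /iso_inv_fun bij_invK.
Qed.

Definition factor_tau (j : 'I_k) (_ : (0 < j)%N) :
  {eq_quot (coord_equiv j)} -> {eq_quot (coord_equiv ord_first)} :=
  bij_inv (coord_bar_bij ord_first) \o @coord_bar j.

Definition factor_str : pow_data := PowData factor_tau.

End PowerStructures.

Section Cosets.
Variables (R : realType) (X : metricType R) (H : set (metric_iso X X)).

Definition iso_lcoset (g : metric_iso X X) : set (metric_iso X X) :=
  [set iso_comp g h | h in H].

Definition iso_quot : Type :=
  {C : set (metric_iso X X) | exists g, C = iso_lcoset g}.

Definition iso_class (g : metric_iso X X) : iso_quot :=
  exist _ (iso_lcoset g) (ex_intro _ g erefl).

End Cosets.

Definition diag_subgroup (R : realType) (k : nat) (P X : metricType R)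
  (phi0 : metric_iso (linf_pow P k) X) : set (metric_iso X X) :=
  [set iso_comp phi0 (iso_comp (pow_iso k f) (iso_inv phi0))
    | f in [set: metric_iso P P]].

(* Main.v *)
Require Import Defs.
From HB Require Import structures.
From mathcomp Require Import all_boot all_order all_algebra.
From mathcomp Require Import boolp classical_sets cardinality reals topology.

(** The map [g |-> F_k(g phi0)] is a bijection on cosets for two reasons.

    First, a power structure remembers the isometry [phi : P^k -> X] up to a
    diagonal isometry of [P^k]: if [phi] and [psi] give the same equivalence
    relations, then the j-th coordinates of [psi] are functions [f_j] of those
    of [phi], and equality of the gluing maps forces all [f_j] to be one
    isometry [f] ([factor_str_eqP]).  For [phi = g phi0] this says that the
    fibers of the map are the cosets of the diagonal subgroup ([eq_lcosetP]).

    Secondly, a power structure on [X] is the same as an isometry of [X] with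
    the k-th power of [Q = X / E_1] ([pow_str_chart]).  So surjectivity means
    that k-th roots are unique: [Q] must be isometric to [rootX]
    ([root_unique]).

    Uniqueness of roots rests on a strict refinement theorem in the style of
    McKenzie.  In a product with the maximum metric the threshold relation
    [d <= r] is the product of the threshold relations of the factors, so
    neighborhoods are boxes; connectedness makes the relation reach every
    point, and separation says that a point is determined by its neighborhood.
    Take two decompositions [X = Y * Z = U * V] and points [x], [x'] with the
    same [Z]-coordinate.  The point with the [U]-coordinate of [x'] and the
    [V]-coordinate of [x] has that [Z]-coordinate too ([fiber_closed]): for an
    edge [x x'] one compares the boxes of common neighbors in both coordinate
    systems, and a path is handled by filling in a grid of such squares.  A
    similar comparison shows that two points which agree in both [Z] and [V]
    still agree in [V] after their common [Z]-coordinate is replaced by another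
    one ([fiber_transport]).

    For an l^infty-prime factor [A_a] and any other decomposition
    [X = Q_1 * ... * Q_k], the first fact makes each line in direction [a] a
    product of its projection to [Q_j] and its projection to the other
    factors.  By primeness one of the two is a point, and by the second fact
    it is the same one for all parallel lines; so every prime direction runs
    inside one [Q_j] ([prime_line]).  Hence each [Q_j] is the product
    of the prime factors assigned to it ([block_chart]), and two prime
    decompositions agree up to a bijection of the factors
    ([unique_factorization]).  If [Q] contains [n_i] factors isometric to
    [A_i], then [X = Q^k] contains [k * n_i] of them, so [m_i = k * n_i], which
    determines [Q]. *)

(** * Strict refinement for a connected relation that separates points *)

Section StrictRefinement.
Set Implicit Arguments.
Unset Strict Implicit.
Context (X : Type) (R : rel X).

(** An identification of [X] with [Y * Z] that turns [R] into a product
    relation, encoded by the operation taking [x] and [y] to the point with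
    the [Y]-coordinate of [x] and the [Z]-coordinate of [y].  The factors never
    have to be named, and exchanging them is [swap].  In the comments below,
    [f] stands for [X = Y * Z] and [g] for [X = U * V]. *)
Record decomposition_op (f : X -> X -> X) : Prop := DecompositionOp {
  dop_id : forall x, f x x = x;
  dop_l : forall x y z, f (f x y) z = f x z;
  dop_r : forall x y z, f x (f y z) = f x z;
  dop_hom : forall a b c d, R a c -> R b d -> R (f a b) (f c d) }.

Definition swap (f : X -> X -> X) : X -> X -> X := fun x y => f y x.

(** Equality, adjacency and inclusion of neighborhoods in the left factor; the
    corresponding notions in the right factor are those of [swap f]. *)
Definition eqL (f : X -> X -> X) (x y : X) : Prop := f x y = y.
Definition relL (f : X -> X -> X) (x y : X) : bool := R (f x y) y.
Definition leL (f : X -> X -> X) (x y : X) : Prop :=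
  forall w, relL f w x -> relL f w y.
Definition le_nbhd (x y : X) : Prop := forall w, R w x -> R w y.

Hypotheses (Rxx : reflexive R) (Rsym : symmetric R).

Lemma swap_dop f : decomposition_op f -> decomposition_op (swap f).
Proof.
by case=> h1 h2 h3 h4; split=> *; rewrite /swap ?h1 ?h2 ?h3 ?h4.
Qed.

Section OneOp.
Context (f : X -> X -> X) (Df : decomposition_op f).
Let Df' := swap_dop Df.

Lemma relL_refl x : relL f x x.
Proof. by rewrite /relL (dop_id Df). Qed.

Lemma relL_sym x y : relL f x y = relL f y x.
Proof.
suff h u v : relL f u v -> relL f v u by apply/idP/idP; exact: h.
rewrite /relL => h; have := dop_hom Df h (Rxx u).
by rewrite (dop_l Df) (dop_id Df) Rsym.
Qed.

Lemma relL_mixl a b c : relL f (f a b) c = relL f a c.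
Proof. by rewrite /relL (dop_l Df). Qed.

Lemma relL_mixr a b c : relL f c (f a b) = relL f c a.
Proof. by rewrite relL_sym relL_mixl relL_sym. Qed.

Lemma eqLC x y : eqL f x y -> eqL f y x.
Proof. by rewrite /eqL => <-; rewrite (dop_l Df) (dop_id Df). Qed.

Lemma eqL_trans y x z : eqL f x y -> eqL f y z -> eqL f x z.
Proof. by rewrite /eqL => hy hz; rewrite -(dop_l Df x y) hy. Qed.

Lemma eqL_mix a b : eqL f (f a b) a.
Proof. by rewrite /eqL (dop_l Df) (dop_id Df). Qed.

Lemma eqL_relL x y (hxy : eqL f x y) w : relL f w x = relL f w y.
Proof. by rewrite -hxy; rewrite relL_mixr. Qed.

Lemma eqL_mix_eq x y (hxy : eqL f x y) z : f x z = f y z.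
Proof. by rewrite -hxy; rewrite (dop_l Df). Qed.

End OneOp.

(** The product form of [R]: this is what the homomorphism axiom [dop_hom] is for. *)
Lemma rel_split f (Df : decomposition_op f) x y :
  R x y = relL f x y && relL (swap f) x y.
Proof.
apply/idP/andP => [h|[h1 h2]].
  split; rewrite /relL.
    by rewrite -{2}(dop_id Df y); exact: (dop_hom Df h (Rxx y)).
  by rewrite /swap -{2}(dop_id Df y); exact: (dop_hom Df (Rxx y) h).
have := dop_hom Df h1 h2.
by rewrite /swap (dop_l Df) (dop_r Df) !(dop_id Df).
Qed.

Lemma relR_mixl f (Df : decomposition_op f) a b c :
  relL (swap f) (f a b) c = relL (swap f) b c.
Proof. exact: (relL_mixl (swap_dop Df) b a c). Qed.

Lemma relR_mixr f (Df : decomposition_op f) a b c :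
  relL (swap f) c (f a b) = relL (swap f) c b.
Proof. exact: (relL_mixr (swap_dop Df) b a c). Qed.

Lemma eqR_mix f (Df : decomposition_op f) a b : eqL (swap f) (f a b) b.
Proof. exact: (eqL_mix (swap_dop Df) b a). Qed.

Definition relE f (Df : decomposition_op f) :=
  (relL_mixl Df, relL_mixr Df, relR_mixl Df, relR_mixr Df).

(** An inclusion of nonempty boxes splits into inclusions of their sides; a
    neighborhood is a nonempty box because [R] is reflexive. *)
Lemma le_nbhd_leL f x y : decomposition_op f -> le_nbhd x y -> leL f x y.
Proof.
move=> Df h w hw; have : R (f w x) y.
  apply: h; rewrite (rel_split Df) // !(relE Df) hw.
  exact: relL_refl (swap_dop Df) x.
by rewrite (rel_split Df) // !(relE Df) => /andP[].
Qed.

Lemma leL_le_nbhd f x y : decomposition_op f ->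
  leL f x y -> leL (swap f) x y -> le_nbhd x y.
Proof.
move=> Df h1 h2 w; rewrite !(rel_split Df w) // => /andP[a b].
by rewrite h1 ?h2.
Qed.

Lemma eqL_leL f x y : decomposition_op f -> eqL f x y -> leL f x y.
Proof. by move=> Df h w; rewrite (eqL_relL Df h w). Qed.

Hypothesis Rthin : forall x y, (forall w, R w x = R w y) -> x = y.

Lemma le_nbhd_anti x y : le_nbhd x y -> le_nbhd y x -> x = y.
Proof. by move=> h1 h2; apply: Rthin => w; apply/idP/idP; [exact: h1|exact: h2]. Qed.

Lemma leL_anti f x y : decomposition_op f ->
  leL f x y -> leL f y x -> eqL f x y.
Proof.
move=> Df h1 h2; apply: Rthin => w.
rewrite !(rel_split Df w) // !(relE Df); congr (_ && _).
by apply/idP/idP; [exact: h1|exact: h2].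
Qed.

(** The point [g x' x] lies between [x] and [x'] for inclusion of
    neighborhoods, and between two points with the same [Z]-coordinate
    antisymmetry leaves only that coordinate. *)
Lemma comparable_step f g x x' : decomposition_op f -> decomposition_op g ->
  eqL (swap f) x x' -> le_nbhd x x' -> eqL (swap f) x (g x' x).
Proof.
move=> Df Dg hz hle; have Df' := swap_dop Df; have Dg' := swap_dop Dg.
have hU := le_nbhd_leL Dg hle.
have hV := le_nbhd_leL Dg' hle.
apply: leL_anti => // w.
  apply: le_nbhd_leL => // {}w; rewrite !(rel_split Dg w) // !(relE Dg).
  by case/andP=> /hU -> ->.
move=> hw; rewrite (eqL_relL Df' hz w); move: w hw.
apply: le_nbhd_leL => // w; rewrite !(rel_split Dg w) // !(relE Dg).
by case/andP=> -> /hV ->.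
Qed.

(** The common neighbors of [x] and [x'] are adjacent to [g x' x], since its
    [U]- and [V]-coordinates are taken from them.  In [Y * Z] they form a box
    whose first side is nonempty, because [x x'] is an edge, and whose second
    side is the neighborhood of the common [Z]-coordinate. *)
Lemma edge_leR f g x x' : decomposition_op f -> decomposition_op g ->
  R x x' -> eqL (swap f) x x' -> leL (swap f) x (g x' x).
Proof.
move=> Df Dg hR hz t ht; have Df' := swap_dop Df.
have h1 : R (f x t) x.
  by rewrite (rel_split Df) // !(relE Df) ht (relL_refl Df).
have h2 : R (f x t) x'.
  rewrite (rel_split Df) // !(relE Df) -(eqL_relL Df' hz t) ht andbT.
  by move: hR; rewrite (rel_split Df) // => /andP[].
suff : R (f x t) (g x' x).
  by rewrite (rel_split Df) // !(relE Df) => /andP[].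
move: h1 h2; rewrite !(rel_split Dg (f x t)) // !(relE Dg).
by move=> /andP[_ ->] /andP[->].
Qed.

(** With [w = g x' x], the point [p = f x w] dominates [x] by [edge_leR].
    Lowering its [V]-coordinate to that of [x] gives [q = g p x], which is
    below [p]; it is also above [p], because [q] has the [Y]-coordinate of [p]
    by [comparable_step] and at least its [Z]-coordinate by [edge_leR] applied
    to the edge [p w].  Thus [p = q]. *)
Lemma edge_diagonal f g x x' : decomposition_op f -> decomposition_op g ->
  R x x' -> eqL (swap f) x x' -> eqL (swap g) x (f x (g x' x)).
Proof.
move=> Df Dg hR hz; have Df' := swap_dop Df; have Dg' := swap_dop Dg.
set w := g x' x; set p := f x w.
have hxw : R x w.
  move: hR; rewrite !(rel_split Dg x) // !(relE Dg) => /andP[-> _] /=.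
  exact: (relL_refl Dg' x).
have hxp : le_nbhd x p.
  apply: (leL_le_nbhd Df) => // t; rewrite (relE Df) //.
  exact: edge_leR.
have hpw : R p w.
  move: hxw; rewrite !(rel_split Df _ w) // !(relE Df) => /andP[-> _] /=.
  exact: (relL_refl Df' w).
have hpq : leL (swap f) p (g p x).
  have := edge_leR Df Dg' hpw (eqR_mix Df x w).
  by rewrite /swap /w (dop_r Dg).
have hxq : eqL f x (g p x).
  exact: (comparable_step Df' Dg (eqLC Df (eqL_mix Df x w)) hxp).
have -> : p = g p x.
  apply: le_nbhd_anti.
    apply: (leL_le_nbhd Df) => //.
    by move=> t; rewrite (relE Df) -(eqL_relL Df hxq t).
  apply: (leL_le_nbhd Dg) => // t; rewrite (relE Dg) //.
  by move: t; exact: le_nbhd_leL.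
exact: (eqLC Dg' (eqR_mix Dg p x)).
Qed.

(** By [edge_leR] only one inclusion is missing: a neighbor of the
    [Z]-coordinate of [w = g x' x] must be a neighbor of that of [x].  By
    [edge_diagonal], [f x w] keeps the [V]-coordinate of [x] and [f x' w] keeps
    the [U]-coordinate of [x'].  Hence a common neighbor [W] of [f x w] and
    [f x' w] has a [V]-coordinate adjacent to that of [x], and replacing this
    coordinate by that of [x'] produces a common neighbor of [f x w] and [x'],
    which must be adjacent to [x]; so the [U]-coordinate of [W] is adjacent to
    that of [x] as well. *)
Lemma edge_step f g x x' : decomposition_op f -> decomposition_op g ->
  R x x' -> eqL (swap f) x x' -> eqL (swap f) x (g x' x).
Proof.
move=> Df Dg hR hz; have Df' := swap_dop Df; have Dg' := swap_dop Dg.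
apply: leL_anti => //; first exact: edge_leR.
set w := g x' x => t ht.
have hp := edge_diagonal Df Dg hR hz.
rewrite -/w in hp.
have hp' : eqL g x' (f x' w).
  have hR' : R x' x by rewrite Rsym.
  exact: (edge_diagonal Df Dg' hR' (eqLC Df' hz)).
have hYx : relL f x x' by move: hR; rewrite (rel_split Df) // => /andP[].
have hVx : relL (swap g) x' x.
  by move: hR; rewrite Rsym (rel_split Dg) // => /andP[].
(* W has the Y-coordinate of x, so its adjacency to x only tests its
   Z-coordinate, which is that of t. *)
set W := f x t.
have Wp : R W (f x w).
  by rewrite (rel_split Df) // !(relE Df) ht (relL_refl Df).
have Wp' : R W (f x' w) by rewrite (rel_split Df) // !(relE Df) hYx.
have WU' : relL g W x'.
  by rewrite (eqL_relL Dg hp' W); move: Wp'; rewrite (rel_split Dg) // => /andP[].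
have [WUp WV] : relL g W (f x w) /\ relL (swap g) W x.
  move: Wp; rewrite (rel_split Dg) // => /andP[-> ].
  by rewrite (eqL_relL Dg' hp W).
suff : R W x by rewrite (rel_split Df) // !(relE Df) => /andP[].
rewrite (rel_split Dg) // WV andbT.
suff : R (g W x') x by rewrite (rel_split Dg) // !(relE Dg) => /andP[].
have h1 : R (g W x') (f x w).
  rewrite (rel_split Dg) // !(relE Dg) WUp /=.
  by rewrite -(eqL_relL Dg' hp x').
have h2 : R (g W x') x'.
  by rewrite (rel_split Dg) // !(relE Dg) WU' (relL_refl Dg').
move: h1 h2; rewrite !(rel_split Df (g W x')) // !(relE Df).
by move=> /andP[-> _] /andP[_ h]; rewrite (eqL_relL Df' hz _).
Qed.

Hypothesis Rconn : forall x y, exists2 s, path R x s & last x s = y.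

(** A path continued by its last point, so that steps need no length bound. *)
Lemma walk x y : exists2 u : nat -> X, u 0 = x /\ (exists n, u n = y) &
  forall i, R (u i) (u i.+1).
Proof.
have [s hs <-] := Rconn x y.
exists (nth (last x s) (x :: s)).
  by split=> //; exists (size s).+1; rewrite nth_default.
move=> i; have [hi|hi] := ltnP i (size s).
  by move/(pathP (last x s)): hs => /(_ i hi).
rewrite [nth _ _ i.+1]/= (nth_default _ hi).
move: hi; rewrite leq_eqVlt => /orP[/eqP <-|hi]; last by rewrite nth_default.
by rewrite nth_last.
Qed.

(** Along a walk in a [Z]-fiber, the points [g (u (i + n)) (u i)] and
    [g (u (i + n + 1)) (u (i + 1))] are adjacent, and mixing the second with
    the first gives [g (u (i + n + 1)) (u i)].  So [edge_step] raises [n]. *)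
Lemma walk_step f g (u : nat -> X) : decomposition_op f -> decomposition_op g ->
  (forall i, R (u i) (u i.+1)) -> (forall i, eqL (swap f) (u 0) (u i)) ->
  forall n i, eqL (swap f) (u 0) (g (u (i + n)%N) (u i)).
Proof.
move=> Df Dg hR hu; have Df' := swap_dop Df.
elim=> [|n IH] i; first by rewrite addn0 (dop_id Dg).
have h1 := IH i; have h2 := IH i.+1.
have hac : R (g (u (i + n)%N) (u i)) (g (u (i.+1 + n)%N) (u i.+1)).
  by apply: dop_hom => //; rewrite addSn.
have hs := eqL_trans Df' (eqLC Df' h1) h2.
have := edge_step Df Dg hac hs.
rewrite (dop_l Dg) (dop_r Dg) addSnnS => h3.
exact: (eqL_trans Df' h1 h3).
Qed.

(** A [Z]-fiber is connected, since a path of [X] can be projected to it by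
    [f]; hence it is a subbox for the decomposition [g]. *)
Lemma fiber_closed f g x x' : decomposition_op f -> decomposition_op g ->
  eqL (swap f) x x' -> eqL (swap f) x (g x' x).
Proof.
move=> Df Dg hz; have Df' := swap_dop Df.
have [u [u0 [n un]] hu] := walk x x'.
(* The path is pushed into the fiber of x, keeping its endpoints. *)
have /= := @walk_step f g (fun i => f (u i) x) Df Dg.
rewrite u0 (dop_id Df) => /(_ _ _ n 0%N); rewrite add0n un u0 (dop_id Df).
have -> : f x' x = x' by exact: hz.
by apply=> i; [exact: (dop_hom Df)|exact: (eqLC Df' (eqR_mix Df _ _))].
Qed.

(** Projecting a path with [f] and then with [g] keeps it in both fibers of [x];
    the second projection does not undo the first by [fiber_closed]. *)
Lemma box_walk f g x x' : decomposition_op f -> decomposition_op g ->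
  eqL (swap f) x x' -> eqL (swap g) x x' ->
  exists2 u : nat -> X, u 0 = x /\ (exists n, u n = x') &
  forall i, [/\ R (u i) (u i.+1), eqL (swap f) x (u i) & eqL (swap g) x (u i)].
Proof.
move=> Df Dg hf hg; have Df' := swap_dop Df; have Dg' := swap_dop Dg.
have [u [u0 [n un]] hu] := walk x x'.
exists (fun i => g (f (u i) x) x).
  rewrite u0 (dop_id Df) (dop_id Dg); split=> //; exists n; rewrite un.
  by have -> : f x' x = x' by [].
move=> i; split.
- by apply: (dop_hom Dg) => //; exact: (dop_hom Df).
- by apply: fiber_closed => //; exact: (eqLC Df' (eqR_mix Df _ _)).
- exact: (eqLC Dg' (eqR_mix Dg _ _)).
Qed.

(** Let [n = g x' xs].  The point [k = f n x] has the [U]-coordinate of [x'] by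
    [fiber_closed], so it suffices to compare [V]-coordinates.  If [W] is
    adjacent to [x] and to [x'], then the [Y]-coordinate of [W] is adjacent to
    that of [n], because moving [W] to the [Z]-coordinate of [x] makes it a
    common neighbor of [x'] and [xs], hence a neighbor of [n]. *)
Lemma square_leL f g x x' xs : decomposition_op f -> decomposition_op g ->
  R x x' -> R x xs ->
  eqL (swap f) x x' -> eqL (swap g) x x' -> eqL f x xs -> eqL g x xs ->
  leL f x' (g x' xs).
Proof.
move=> Df Dg hR hRs zz vv yy uu; have Df' := swap_dop Df; have Dg' := swap_dop Dg.
set n := g x' xs.
have hk : eqL g x' (f n x).
  have h : eqL g x' n by exact: (eqLC Dg (eqL_mix Dg _ _)).
  have -> : f n x = f n x' by exact: (eqL_mix_eq Df' zz n).
  exact: (fiber_closed Dg' Df h).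
suff : le_nbhd x' (f n x).
  by move/(le_nbhd_leL Df) => h w /h; rewrite (relE Df).
apply: (leL_le_nbhd Dg) => //; first exact: eqL_leL.
move=> t; rewrite -(eqL_relL Dg' vv t) => ht.
set W := g x t.
have hW : R W x by rewrite (rel_split Dg) // !(relE Dg) ht (relL_refl Dg).
have hW' : R W x'.
  rewrite (rel_split Dg) // !(relE Dg) -(eqL_relL Dg' vv t) ht andbT.
  by move: hR; rewrite (rel_split Dg) // => /andP[].
suff : R W (f n x) by rewrite (rel_split Dg) // !(relE Dg) => /andP[].
move: hW hW'; rewrite !(rel_split Df W) // !(relE Df) => /andP[Wy Wz] /andP[Wy' _].
rewrite Wz andbT.
suff : R (f W x) n by rewrite (rel_split Df) // !(relE Df) => /andP[].
have h1 : R (f W x) x'.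
  by rewrite (rel_split Df) // !(relE Df) Wy' -(eqL_relL Df' zz x) (relL_refl Df').
have h2 : R (f W x) xs.
  rewrite (rel_split Df) // !(relE Df) -(eqL_relL Df yy W) Wy /=.
  by move: hRs; rewrite (rel_split Df) // => /andP[].
move: h1 h2; rewrite !(rel_split Dg (f W x)) // !(relE Dg).
by move=> /andP[-> _] /andP[_ ->].
Qed.

(** The hypotheses are symmetric under exchanging [f] with [g] and under
    swapping the sides together with [x'] and [xs], so four instances of
    [square_leL] give both inclusions of neighborhoods. *)
Lemma square_commute f g x x' xs : decomposition_op f -> decomposition_op g ->
  R x x' -> R x xs ->
  eqL (swap f) x x' -> eqL (swap g) x x' -> eqL f x xs -> eqL g x xs ->
  f x' xs = g x' xs.
Proof.
move=> Df Dg hR hRs zz vv yy uu; have Df' := swap_dop Df; have Dg' := swap_dop Dg.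
apply: le_nbhd_anti.
  apply: (leL_le_nbhd Df) => // w; rewrite (relE Df); move: w.
    exact: (square_leL Df Dg hR hRs zz vv yy uu).
  exact: (square_leL Df' Dg' hRs hR yy uu zz vv).
apply: (leL_le_nbhd Dg) => // w; rewrite (relE Dg); move: w.
  exact: (square_leL Dg Df hR hRs vv zz uu yy).
exact: (square_leL Dg' Df' hRs hR uu yy vv zz).
Qed.

(** Two walks, one inside the common [Z]- and [V]-fiber of [x] and one inside
    its common [Y]- and [U]-fiber, span a grid; the cells are filled one by one
    with [square_commute]. *)
Lemma box_commute f g x x' xs : decomposition_op f -> decomposition_op g ->
  eqL (swap f) x x' -> eqL (swap g) x x' -> eqL f x xs -> eqL g x xs ->
  f x' xs = g x' xs.
Proof.
move=> Df Dg zz vv yy uu; have Df' := swap_dop Df; have Dg' := swap_dop Dg.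
have [u [u0 [n <-]] hu] := box_walk Df Dg zz vv.
have [t [t0 [m <-]] ht] := box_walk Df' Dg' yy uu.
elim: n m => [|n IHn] m.
  by rewrite u0; have [_ h1 h2] := ht m; rewrite [LHS]h1 [RHS]h2.
elim: m => [|m IHm].
  by rewrite t0; have [_ h1 h2] := hu n.+1; rewrite [LHS]h1 [RHS]h2.
have [hun _ _] := hu n; have [htm _ _] := ht m.
have := square_commute Df Dg (x := f (u n) (t m)) (x' := f (u n.+1) (t m))
  (xs := f (u n) (t m.+1)).
rewrite (dop_l Df) (dop_r Df) => ->.
- by rewrite IHm IHn (dop_l Dg) (dop_r Dg).
- exact: (dop_hom Df).
- exact: (dop_hom Df).
- by rewrite /eqL /swap (dop_r Df) (dop_l Df).
- by rewrite /eqL /swap IHm IHn (dop_r Dg) (dop_l Dg).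
- by rewrite /eqL (dop_l Df) (dop_r Df).
- by rewrite /eqL !IHn (dop_l Dg) (dop_r Dg).
Qed.

(** The displacement from [x] to [ys = f x xs] is cut into a part
    along [U], which [fiber_closed] handles, and a part along [V], which
    [box_commute] handles. *)
Lemma fiber_transport f g x x' xs :
  decomposition_op f -> decomposition_op g ->
  eqL (swap f) x x' -> eqL (swap g) x x' ->
  eqL (swap g) (f x xs) (f x' xs).
Proof.
move=> Df Dg zz vv; have Df' := swap_dop Df; have Dg' := swap_dop Dg.
set ys := f x xs.
have -> : f x' xs = f x' ys by rewrite /ys (dop_r Df).
have yy : eqL f x ys by exact: (eqLC Df (eqL_mix Df _ _)).
(* The corner between the two parts: already at the U-coordinate of ys,
   still at the V-coordinate of x. *)
set m := g ys x.
have ym : eqL f x m by exact: (fiber_closed Df' Dg yy).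
have vm : eqL (swap g) x m by exact: (eqLC Dg' (eqR_mix Dg _ _)).
have mm' : eqL (swap g) m (f x' m).
  exact: (fiber_closed Dg Df (eqL_trans Dg' (eqLC Dg' vm) vv)).
have := box_commute Df Dg (x := m) (x' := f x' m) (xs := ys).
rewrite (dop_l Df) => ->.
- exact: (eqLC Dg' (eqR_mix Dg _ _)).
- exact: (eqLC Df' (eqR_mix Df _ _)).
- exact: mm'.
- exact: (eqL_trans Df (eqLC Df ym) yy).
- exact: (eqL_mix Dg).
Qed.

End StrictRefinement.

(** * Product charts and lines of a metric space *)

Section Charts.
Set Implicit Arguments.
Unset Strict Implicit.
Import Order.TTheory GRing.Theory Num.Theory.
Local Open Scope ring_scope.
Context (R : realType).
Implicit Type X : metricType R.

Lemma mdist_le0 X (x y : X) : (mdist x y <= 0) -> x = y.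
Proof.
by move=> h; apply: mdist_positivity; apply: le_anti; rewrite h mdist_ge0.
Qed.

(** Distances in a product are known through the bounds they satisfy. *)
Lemma eq_of_le (s t : R) : 0 <= s -> 0 <= t ->
  (forall a, 0 <= a -> s <= a <-> t <= a) -> s = t.
Proof.
move=> s0 t0 h; apply: le_anti; apply/andP; split.
  by apply/(h t).
by apply/(h s).
Qed.

Lemma bigmax_of_le (k : nat) (F : 'I_k -> R) (t : R) :
  0 <= t -> (forall a, 0 <= a -> t <= a <-> forall j, F j <= a) ->
  t = \big[Num.max/0]_(j < k) F j.
Proof.
move=> t0 h; apply: eq_of_le => // [|a a0]; first by apply: bigmax_ge_id.
rewrite h //; split=> [H|/bigmax_leP[_ H] j]; last exact: H.
by apply/bigmax_leP.
Qed.

(** The coordinate functions of an isometry of [X] with the product of the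
    [P i].  Unlike isometries, they can be regrouped, reindexed and refined
    factor by factor without casts between product spaces.  The bound [a = 0]
    in the second clause gives injectivity. *)
Definition product_chart X (I : finType) (P : I -> metricType R)
    (c : forall i, X -> P i) : Prop :=
  (forall p : (forall i, P i), exists x, forall i, c i x = p i) /\
  (forall x y a, 0 <= a ->
     mdist x y <= a <-> forall i, mdist (c i x) (c i y) <= a).

Definition agree X (I : finType) (P : I -> metricType R)
    (c : forall i, X -> P i) (S : pred I) (x y : X) : Prop :=
  forall i, S i -> c i x = c i y.

Lemma sval_inj (T : Type) (Q : T -> Prop) (u v : {x | Q x}) :
  sval u = sval v -> u = v.
Proof.
case: u v => [x hx] [y hy] /= e; move: hx; rewrite e => hx.
by congr exist; exact: Prop_irrelevance.
Qed.

Definition sub_metric X (S : set X) : Type := {x : X | S x}.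

Section SubMetric.
Context (X : metricType R) (S : set X).
HB.instance Definition _ := gen_eqMixin (sub_metric S).
HB.instance Definition _ := gen_choiceMixin (sub_metric S).

Let sub_dist (u v : sub_metric S) : R := mdist (sval u) (sval v).
Let sub_distxx u : sub_dist u u = 0. Proof. exact: mdistxx. Qed.
Let sub_dist_pos u v : sub_dist u v = 0 -> u = v.
Proof. by move/mdist_positivity/sval_inj. Qed.
Let sub_dist_sym u v : sub_dist u v = sub_dist v u.
Proof. exact: metric_sym. Qed.
Let sub_dist_tri v u w : sub_dist u w <= sub_dist u v + sub_dist v w.
Proof. exact: metric_triangle. Qed.

HB.instance Definition _ := @isMetric.Build R (sub_metric S) sub_dist
  sub_distxx sub_dist_pos sub_dist_sym sub_dist_tri.
End SubMetric.

Section OneChart.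
Context X (I : finType) (P : I -> metricType R) (c : forall i, X -> P i).
Hypothesis hc : product_chart c.

Lemma chart_inj x y : (forall i, c i x = c i y) -> x = y.
Proof.
move=> h; apply: mdist_le0; apply/(proj2 hc) => // i.
by rewrite h mdistxx.
Qed.

(** The decomposition operation that groups the coordinates into [S] and its
    complement. *)
Definition recombine (S : pred I) (x y : X) : X :=
  sval (cid (proj1 hc (fun i => if S i then c i x else c i y))).

Lemma recombineE S x y i :
  c i (recombine S x y) = if S i then c i x else c i y.
Proof. by rewrite /recombine; case: cid => z /= ->. Qed.

Lemma recombineC S x y : recombine S x y = recombine (predC S) y x.
Proof. by apply: chart_inj => i; rewrite !recombineE /=; case: (S i). Qed.

Lemma eqL_agree S x y : eqL (recombine S) x y <-> agree c S x y.
Proof.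
split=> [h i Si|h].
  by rewrite -h recombineE Si.
apply: chart_inj => i; rewrite recombineE.
by case: (boolP (S i)) => // /h.
Qed.

Lemma eqR_agree S x y :
  eqL (swap (recombine S)) x y <-> agree c (predC S) x y.
Proof. by rewrite -eqL_agree /eqL /swap recombineC. Qed.

Lemma recombine_dop (r : R) S : 0 <= r ->
  decomposition_op (@threshold R X r) (recombine S).
Proof.
move=> r0; split=> [x|x y z|x y z|x y z t].
- by apply: chart_inj => i; rewrite recombineE; case: (S i).
- by apply: chart_inj => i; rewrite !recombineE; case: (S i).
- by apply: chart_inj => i; rewrite !recombineE; case: (S i).
move=> /(proj2 hc _ _ _ r0) h1 /(proj2 hc _ _ _ r0) h2.
apply/(proj2 hc) => // i; rewrite !recombineE.
by case: (S i).
Qed.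

Definition line (a : I) (x y : X) : Prop := agree c (predC (pred1 a)) x y.

Lemma line_dist a x y : line a x y -> mdist x y = mdist (c a x) (c a y).
Proof.
move=> h; apply: eq_of_le; rewrite ?mdist_ge0 // => t t0.
rewrite (proj2 hc) //; split=> [//|ha i].
have [->//|ia] := eqVneq i a.
by rewrite h // mdistxx.
Qed.

Lemma line_point a (x0 : X) (y : P a) : exists x, c a x = y /\ line a x0 x.
Proof.
have [x hx] := proj1 hc (dfwith (fun i => c i x0) y).
exists x; rewrite hx dfwith_in; split=> // i /= ia.
by rewrite hx dfwith_out // eq_sym.
Qed.

Definition on_line a (x0 : X) (y : P a) : X := sval (cid (line_point x0 y)).

Lemma on_lineE a x0 (y : P a) : c a (on_line x0 y) = y.
Proof. by rewrite /on_line; case: cid => x []. Qed.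

Lemma on_line_line a x0 (y : P a) : line a x0 (on_line x0 y).
Proof. by rewrite /on_line; case: cid => x []. Qed.

Lemma on_line2 a x0 (y y' : P a) : line a (on_line x0 y) (on_line x0 y').
Proof. by move=> i ia; rewrite -!(on_line_line x0 _ ia). Qed.

Lemma line_inj a x y : line a x y -> c a x = c a y -> x = y.
Proof.
move=> h ha; apply: chart_inj => i.
by have [->//|ia] := eqVneq i a; exact: h.
Qed.

Lemma agree_sym S x y : agree c S x y -> agree c S y x.
Proof. by move=> h i Si; rewrite h. Qed.

Lemma agree_trans S y x z : agree c S x y -> agree c S y z -> agree c S x z.
Proof. by move=> h1 h2 i Si; rewrite h1 ?h2. Qed.

Lemma agree_recombine S x y : agree c S (recombine S x y) x.
Proof. by move=> i Si; rewrite recombineE Si. Qed.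

Lemma agreeC_recombine S x y : agree c (predC S) (recombine S x y) y.
Proof. by move=> i /negbTE Si; rewrite recombineE Si. Qed.

End OneChart.

(** Nonnegativity makes the threshold relation reflexive, so that neighborhoods
    are nonempty. *)
Definition connected_thin X (r : R) : Prop :=
  [/\ 0 <= r, connected_over (@threshold R X r)
    & separating_over (@threshold R X r)].

Section TwoCharts.
Context X (r : R) (hX : connected_thin X r).
Context (I : finType) (P : I -> metricType R) (c : forall i, X -> P i).
Hypothesis hc : product_chart c.
Context (J : finType) (Q : J -> metricType R) (q : forall j, X -> Q j).
Hypothesis hq : product_chart q.

Lemma threshold_thin x y :
  (forall w : X, threshold r w x = threshold r w y) -> x = y.
Proof.
move=> h; have [_ _ hs] := hX; apply: contrapT => /hs [z].
by rewrite h addbb.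
Qed.

Lemma threshold_conn (x y : X) :
  exists2 s, path (@threshold R X r) x s & last x s = y.
Proof.
have [_ hco _] := hX.
by have [->|/hco//] := pselect (x = y); exists [::].
Qed.

Lemma threshold_refl : reflexive (@threshold R X r).
Proof. by move=> x; rewrite /threshold mdistxx; case: hX. Qed.

Lemma threshold_sym : symmetric (@threshold R X r).
Proof. by move=> x y; rewrite /threshold metric_sym. Qed.

Lemma agree_recombine_closed S T x x' : agree c S x x' ->
  agree c S x (recombine hq T x' x).
Proof.
have [r0 _ _] := hX => h.
have Df := swap_dop (recombine_dop hc S r0); have Dg := recombine_dop hq T r0.
apply/(eqL_agree hc).
apply: (fiber_closed threshold_refl threshold_sym threshold_thin
  threshold_conn Df Dg).
exact/(eqL_agree hc).
Qed.

Lemma agree_transport S T x x' xs : agree c (predC S) x x' -> agree q T x x' ->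
  agree q T (recombine hc S x xs) (recombine hc S x' xs).
Proof.
have [r0 _ _] := hX => h1 h2.
have Df := recombine_dop hc S r0; have Dg := swap_dop (recombine_dop hq T r0).
apply/(eqL_agree hq).
move/(eqR_agree hc) in h1; move/(eqL_agree hq) in h2.
exact: (fiber_transport threshold_refl threshold_sym threshold_thin
  threshold_conn xs Df Dg h1 h2).
Qed.

(** Any line in direction [a] is the transport of the one through [x0]. *)
Lemma line_transport a T x0 :
  (forall x, line c a x0 x -> agree q T x0 x) ->
  forall x1 x2, line c a x1 x2 -> agree q T x1 x2.
Proof.
move=> h x1 x2 h12.
have [y1 [e1 l1]] := line_point hc x0 (c a x1).
have [y2 [e2 l2]] := line_point hc x0 (c a x2).
have hy : agree q T y1 y2 by apply: agree_trans (h _ l2); apply: agree_sym; exact: h.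
have ly : line c a y1 y2 by apply: agree_trans l2; exact: agree_sym.
have := agree_transport x1 ly hy.
have -> : recombine hc (pred1 a) y1 x1 = x1.
  apply: (chart_inj hc) => i; rewrite recombineE /=.
  by case: eqVneq => // ->.
suff -> : recombine hc (pred1 a) y2 x1 = x2 by [].
apply: (chart_inj hc) => i; rewrite recombineE /=.
by case: eqVneq => [->|ia] //; exact: h12.
Qed.

(** By closure under recombination, the line through [x0] in direction [a] is a
    subbox for the decomposition into [Q j] and the other factors.  Both of its
    sides are realized as subspaces of the line itself. *)
Lemma line_split a j (x0 : X) :
  isometric (P a)
    (sub_metric [set x : X | line c a x0 x /\ line q j x0 x] *
     sub_metric [set x : X | line c a x0 x /\ agree q (pred1 j) x0 x])%type.
Proof.
set G := recombine hq (pred1 j).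
have lG x y : line c a x0 x -> line c a x0 y -> line c a x0 (G x y).
  move=> hx hy; apply: (agree_trans hy).
  by apply: agree_recombine_closed; apply: agree_trans hx; exact: agree_sym.
pose pt := on_line hc x0 (a := a).
have ptE y : c a (pt y) = y := on_lineE hc x0 y.
have ptl y : line c a x0 (pt y) := on_line_line hc x0 y.
have hU y : line c a x0 (G (pt y) x0) /\ line q j x0 (G (pt y) x0).
  split; first exact: lG.
  by apply: agree_sym; exact: agreeC_recombine.
have hV y : line c a x0 (G x0 (pt y)) /\ agree q (pred1 j) x0 (G x0 (pt y)).
  split; first exact: lG.
  by apply: agree_sym; exact: agree_recombine.
pose F (y : P a) : (sub_metric [set x : X | line c a x0 x /\ line q j x0 x] *
     sub_metric [set x : X | line c a x0 x /\ agree q (pred1 j) x0 x])%type :=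
  (exist _ _ (hU y), exist _ _ (hV y)).
constructor; exists F; split.
  exists (fun uv => c a (G (sval uv.1) (sval uv.2))) 
    => [y|[[u [u1 u2]] [v [v1 v2]]]].
    rewrite -[RHS]ptE /=; congr (c a _); apply: (chart_inj hq) => l.
    by rewrite !recombineE; case: (pred1 j l).
  have e : pt (c a (G u v)) = G u v.
    apply: (line_inj hc (a := a)); last by rewrite ptE.
    by apply: agree_trans (lG _ _ u1 v1); apply: agree_sym; exact: ptl.
  rewrite /F /=; congr pair; apply: sval_inj; rewrite /= e;
    apply: (chart_inj hq) => l; rewrite !recombineE /=.
    by case: eqVneq => // lj; exact: u2.
  by case: eqVneq => [->|//]; apply: v2 => /=.
move=> y y'; have -> : mdist y y' = mdist (pt y) (pt y').
  by rewrite (line_dist hc (on_line2 hc x0 y y')) !ptE.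
apply: eq_of_le; rewrite ?mdist_ge0 // => t t0.
rewrite [mdist _ _]/(Num.max (mdist (G (pt y) x0) (G (pt y') x0))
                             (mdist (G x0 (pt y)) (G x0 (pt y')))).
rewrite ge_max (proj2 hq (pt y)) //; split.
  move=> /andP[/(proj2 hq _ _ _ t0) h1 /(proj2 hq _ _ _ t0) h2] i.
  move: (h1 i) (h2 i); rewrite !recombineE /=.
  by case: eqVneq.
move=> h; apply/andP; split; apply/(proj2 hq) => // i; rewrite !recombineE /=.
  by case: eqVneq => // _; rewrite mdistxx.
by case: eqVneq => // _; rewrite mdistxx.
Qed.

(** Primeness makes one side of [line_split] a point at [x0]; [line_transport]
    makes the choice independent of [x0]. *)
Lemma prime_line_alternative a j (x0 : X) : linf_prime (P a) ->
  (forall x x', line c a x x' -> agree q (pred1 j) x x') \/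
  (forall x x', line c a x x' -> line q j x x').
Proof.
move=> [_ /(_ _ _ (line_split a j x0)) [[u hu]|[v hv]]]; [left|right];
    apply: (@line_transport a _ x0) => x hx.
  have all_eq (w : sub_metric _) : w = u.
    by have : (@classical_sets.setT (sub_metric _)) w by []; rewrite hu.
  have hw : line c a x0 (recombine hq (pred1 j) x x0) /\
            line q j x0 (recombine hq (pred1 j) x x0).
    split; first exact: agree_recombine_closed.
    by apply: agree_sym; exact: agreeC_recombine.
  have hw0 : line c a x0 x0 /\ line q j x0 x0 by [].
  have /= e := congr1 sval
    (etrans (all_eq (exist _ _ hw)) (esym (all_eq (exist _ _ hw0)))).
  by move=> i /= ij; rewrite -{1}e recombineE /= ij.
have all_eq (w : sub_metric _) : w = v.
  by have : (@classical_sets.setT (sub_metric _)) w by []; rewrite hv.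
(* Now the coordinates other than j are moved to those of x. *)
have hw : line c a x0 (recombine hq (predC (pred1 j)) x x0) /\
          agree q (pred1 j) x0 (recombine hq (predC (pred1 j)) x x0).
  split; first exact: agree_recombine_closed.
  by apply: agree_sym; rewrite -recombineC; exact: agree_recombine.
have hw0 : line c a x0 x0 /\ agree q (pred1 j) x0 x0 by [].
have /= e := congr1 sval
  (etrans (all_eq (exist _ _ hw)) (esym (all_eq (exist _ _ hw0)))).
by move=> i /= ij; rewrite -{1}e recombineE /= ij.
Qed.

(** If the first alternative held for every [j], all coordinates would be
    constant along the lines in direction [a], which have more than one
    point. *)
Lemma prime_line a (x0 : X) : linf_prime (P a) ->
  exists j, forall x x', line c a x x' -> line q j x x'.
Proof.
move=> Pa; apply: contrapT => /forallNP h.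
have {}h j x x' : line c a x x' -> q j x = q j x'.
  move=> l; case: (prime_line_alternative j x0 Pa) => [/(_ _ _ l)|/h//].
  by apply=> /=.
have [[y [y' ny]] _] := Pa; apply: ny.
have [x [<- l]] := line_point hc x0 y.
have [x' [<- l']] := line_point hc x0 y'.
congr (c a _); apply: (chart_inj hq) => j; apply: h.
by apply: agree_trans l'; exact: agree_sym.
Qed.

End TwoCharts.

End Charts.

(** * Prime factors are assigned to the factors of any decomposition *)

Section Factorization.
Set Implicit Arguments.
Unset Strict Implicit.
Import Order.TTheory GRing.Theory Num.Theory.
Local Open Scope ring_scope.
Context (R : realType).
Implicit Type X : metricType R.

Section Blocks.
Context X (r : R) (hX : connected_thin X r) (x0 : X).
Context (I : finType) (P : I -> metricType R) (c : forall i, X -> P i).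
Hypotheses (hc : product_chart c) (P_prime : forall i, linf_prime (P i)).
Context (J : finType) (Q : J -> metricType R) (q : forall j, X -> Q j).
Hypothesis hq : product_chart q.

Lemma prime_lines : exists s : I -> J,
  forall a x x', line c a x x' -> line q (s a) x x'.
Proof.
have h a : exists j, forall x x', line c a x x' -> line q j x x'.
  exact: (prime_line hX hc hq x0 (P_prime a)).
by have [s hs] := choice h; exists s.
Qed.

Context (s : I -> J).
Hypothesis hs : forall a x x', line c a x x' -> line q (s a) x x'.

(** Coordinates are changed one at a time: those outside the block of [j] move
    the point along a line of some other [Q l], and those inside do not change
    at all. *)
Lemma block_determines j x x' :
  agree c (fun b => s b == j) x x' -> q j x = q j x'.
Proof.
move=> h; pose z (t : seq I) := recombine hc (mem t) x' x.
suff hz t : q j x = q j (z t).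
  rewrite (hz (enum I)); congr (q j _); apply: (chart_inj hc) => i.
  by rewrite recombineE /= mem_enum.
elim: t => [|a t ->].
  by congr (q j _); apply: (chart_inj hc) => i; rewrite recombineE.
have l : line c a (z t) (z (a :: t)).
  by move=> i /= ia; rewrite !recombineE /= inE (negbTE ia).
have [e|ne] := eqVneq (s a) j; last by apply: (hs l); rewrite /= eq_sym.
congr (q j _); apply: (line_inj hc l); rewrite !recombineE /= inE eqxx /=.
by case: ifP => // _; apply: h; exact/eqP.
Qed.

(** Replacing only the coordinates of [x] in the block by those of [x'] changes
    no [q l], by [block_determines] for each block; so it changes nothing. *)
Lemma determines_block j x x' :
  q j x = q j x' -> agree c (fun b => s b == j) x x'.
Proof.
move=> h; pose z := recombine hc (fun b => s b == j) x' x.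
have -> : x = z; last exact: agree_recombine.
apply: (chart_inj hq) => l; have [->|lj] := eqVneq l j.
  rewrite h; apply: block_determines; apply: agree_sym.
  exact: agree_recombine.
apply: block_determines => b /eqP bl.
by rewrite recombineE bl (negbTE lj).
Qed.

(** By [block_determines] and [determines_block], the coordinate [q j] and the
    coordinates in its block carry the same information; [Q j] is charted by
    the latter on the line through [x0]. *)
Lemma block_chart j : exists e : forall b : {b | s b == j}, Q j -> P (val b),
  product_chart e.
Proof.
pose pt := on_line hq x0 (a := j).
have ptE y : q j (pt y) = y := on_lineE hq x0 y.
exists (fun b y => c (val b) (pt y)); split=> [p|y y' a a0].
  (* The coordinates outside the block only have to be filled in somehow. *)
  have [x hx] := proj1 hc (fun b => match @boolP (s b == j) with
    | AltTrue h => p (exist _ b h) | AltFalse _ => c b x0 end).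
  exists (q j x) => -[b hb] /=.
  rewrite (determines_block (ptE (q j x)) hb) hx.
  case: {-}_ / boolP => [h|]; last by rewrite hb.
  by congr (p (exist _ _ _)); exact: bool_irrelevance.
have l : line q j (pt y) (pt y') := on_line2 hq x0 y y'.
have -> : mdist y y' = mdist (pt y) (pt y') by rewrite (line_dist hq l) !ptE.
rewrite (proj2 hc) //; split=> [h b|h b]; first exact: h.
have [sb|nb] := boolP (s b == j); first exact: (h (exist _ b sb)).
by rewrite (determines_block (l _ nb) (eqxx _)) mdistxx.
Qed.

End Blocks.

(** A line in direction [a] has two points, but a line in two distinct
    directions has one. *)
Lemma prime_line_inj X (x0 : X) (I : finType) (P : I -> metricType R)
    (c : forall i, X -> P i) (hc : product_chart c) a b :
  linf_prime (P a) -> (forall x x', line c a x x' -> line c b x x') -> a = b.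
Proof.
move=> [[y [y' ny]] _] h; apply/eqP; apply: contrapT => /negP ab; apply: ny.
have [x [<- l]] := line_point hc x0 y.
have [x' [<- l']] := line_point hc x0 y'.
apply: h ab; apply: agree_trans l'; exact: agree_sym.
Qed.

(** The assignments of directions in both senses are mutually inverse, since a
    line in direction [a] stays in a line in direction [t (s a)].  Lines in the
    directions [a] and [s a] through [x0] are then the same subset of [X], and
    this subset is isometric to both factors. *)
Lemma unique_factorization X (r : R) (hX : connected_thin X r) (x0 : X)
    (I : finType) (P : I -> metricType R) (c : forall i, X -> P i)
    (J : finType) (Q : J -> metricType R) (q : forall j, X -> Q j) :
  product_chart c -> (forall i, linf_prime (P i)) ->
  product_chart q -> (forall j, linf_prime (Q j)) ->
  exists2 s : I -> J, bijective s & forall a, isometric (P a) (Q (s a)).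
Proof.
move=> hc hP hq hQ.
have [s hs] := prime_lines hX x0 hc hP hq.
have [t ht] := prime_lines hX x0 hq hQ hc.
have sK : cancel s t.
  move=> a; apply: esym; apply: (prime_line_inj x0 hc (hP a)) => x x' l.
  exact/ht/hs.
have tK : cancel t s.
  move=> a; apply: esym; apply: (prime_line_inj x0 hq (hQ a)) => x x' l.
  exact/hs/ht.
exists s; first by exists t.
move=> a.
pose pt := on_line hc x0 (a := a).
have ptE y : c a (pt y) = y := on_lineE hc x0 y.
have ptl y : line c a x0 (pt y) := on_line_line hc x0 y.
have ptl2 y y' : line c a (pt y) (pt y') := on_line2 hc x0 y y'.
pose qt := on_line hq x0 (a := s a).
have qtE y : q (s a) (qt y) = y := on_lineE hq x0 y.
have qtl y : line q (s a) x0 (qt y) := on_line_line hq x0 y.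
constructor; exists (fun y => q (s a) (pt y)); split.
  exists (fun z => c a (qt z)) => [y|z].
    rewrite -[RHS]ptE; congr (c a _); apply: (line_inj hq (a := s a)) => //.
    by apply: agree_trans (agree_sym (qtl _)) _; apply: hs.
  rewrite -[RHS]qtE; congr (q _ _); apply: (line_inj hc (a := a)) => //.
  apply: agree_trans (agree_sym (ptl _)) _.
  by have := ht _ _ _ (qtl z); rewrite sK.
move=> y y'; rewrite -(line_dist hq) ?(line_dist hc (ptl2 y y')) ?ptE //.
exact/hs.
Qed.

Lemma iso_chart X (I : finType) (P : I -> metricType R)
    (h : metric_iso X (linf_prod P)) : product_chart (fun i x => h x i).
Proof.
split=> [p|x y a a0].
  by exists (iso_inv h p) => i; rewrite /= /iso_inv_fun bij_invKV.
by rewrite -(proj2 (isoP h)); exact: linf_dist_le.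
Qed.

Lemma chart_isometric X X' (I : finType) (P : I -> metricType R)
    (c : forall i, X -> P i) (c' : forall i, X' -> P i) :
  product_chart c -> product_chart c' -> isometric X X'.
Proof.
move=> hc hc'.
pose f x := sval (cid (proj1 hc' (fun i => c i x))).
have fE x i : c' i (f x) = c i x by rewrite /f; case: cid => ? /= ->.
pose g x := sval (cid (proj1 hc (fun i => c' i x))).
have gE x i : c i (g x) = c' i x by rewrite /g; case: cid => ? /= ->.
constructor; exists f; split.
  exists g => x; [apply: (chart_inj hc)|apply: (chart_inj hc')] => i.
    by rewrite gE fE.
  by rewrite fE gE.
move=> x y; apply: eq_of_le; rewrite ?mdist_ge0 // => a a0.
rewrite (proj2 hc') // (proj2 hc) //.
by split=> h i; have := h i; rewrite !fE.
Qed.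

Lemma chart_reindex X (I J : finType) (P : I -> metricType R)
    (Q : J -> metricType R) (c : forall i, X -> P i) (e : J -> I) :
  product_chart c -> bijective e -> (forall j, isometric (P (e j)) (Q j)) ->
  exists q : forall j, X -> Q j, product_chart q.
Proof.
move=> hc [e' eK e'K] hPQ.
pose h j : metric_iso (P (e j)) (Q j) := inhabited_witness (hPQ j).
exists (fun j x => h j (c (e j) x)); split=> [p|x y a a0].
  (* Quantifying over every proof of i = e j spares transporting along the
     one that comes with the inverse of e. *)
  have hv i : exists v : P i,
      forall j (E : i = e j), h j (ecast l (P l) E v) = p j.
    rewrite -(e'K i); set j0 := e' i.
    exists (iso_inv (h j0) (p j0)) => j E.
    have j0j : j0 = j by rewrite -(eK j0) E eK.
    case: _ / j0j E => E; rewrite eq_axiomK /= /iso_inv_fun.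
    exact: bij_invKV.
  pose v i := sval (cid (hv i)).
  have vE i j (E : i = e j) : h j (ecast l (P l) E (v i)) = p j.
    by rewrite /v; case: cid.
  have [x hx] := proj1 hc v.
  by exists x => j; rewrite hx (vE _ j erefl).
rewrite (proj2 hc) //; split=> H i.
  by rewrite (proj2 (isoP (h i))).
by rewrite -(e'K i) -(proj2 (isoP (h (e' i)))).
Qed.

Lemma chart_sigma X (I : finType) (P : I -> metricType R)
    (T : I -> finType) (A : forall i, T i -> metricType R)
    (c : forall i, X -> P i) (e : forall i (t : T i), P i -> A i t) :
  product_chart c -> (forall i, product_chart (e i)) ->
  product_chart (fun (u : {i : I & T i}) x =>
    (e (tag u) (tagged u) (c (tag u) x) : A (tag u) (tagged u))).
Proof.
move=> hc he; split=> [p|x y a a0].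
  pose y i := sval (cid (proj1 (he i) (fun t => p (Tagged T t)))).
  have yE i t : e i t (y i) = p (Tagged T t) by rewrite /y; case: cid => z /= ->.
  have [x hx] := proj1 hc y.
  by exists x => -[i t]; rewrite hx yE.
rewrite (proj2 hc) //; split=> h.
  by move=> [i t] /=; apply: (proj1 (proj2 (he i) _ _ _ a0)).
by move=> i; apply/(proj2 (he i) _ _ _ a0) => t; exact: (h (Tagged T t)).
Qed.

(** Elements of corresponding fibers are matched by their rank in the fiber. *)
Lemma equal_fibers_bij (S T T' : finType) (t : T -> S) (t' : T' -> S) :
  (forall i, #|[pred a | t a == i]| = #|[pred a | t' a == i]|) ->
  exists2 e : T -> T', bijective e & forall a, t' (e a) = t a.
Proof.
move=> h.
pose F i := enum [pred a | t a == i]; pose F' i := enum [pred a | t' a == i].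
have sz i : size (F i) = size (F' i) by rewrite -!cardE h.
have ha a : a \in F (t a) by rewrite mem_enum inE.
have hi a : (index a (F (t a)) < size (F' (t a)))%N by rewrite -sz index_mem.
have hex a : exists b, b \in F' (t a) /\ index b (F' (t a)) = index a (F (t a)).
  have [b0 _] : exists b : T', true.
    by move: (hi a); case: (F' (t a)) => // b; exists b.
  exists (nth b0 (F' (t a)) (index a (F (t a)))).
  by rewrite mem_nth // index_uniq // enum_uniq.
have [e he] := choice hex.
have te a : t' (e a) = t a.
  by have [] := he a; rewrite mem_enum inE => /eqP.
exists e => //; apply: inj_card_bij.
  move=> a b eab; have tab : t a = t b by rewrite -!te eab.
  have [_ h1] := he a; have [_ h2] := he b.
  have ib : index a (F (t a)) = index b (F (t a)) by rewrite -h1 eab tab h2.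
  rewrite -(nth_index a (ha a)) ib nth_index // tab; exact: ha.
rewrite -sum1_card -[leqRHS]sum1_card.
rewrite (partition_big t' xpredT) //= [leqRHS](partition_big t xpredT) //=.
by apply: leq_sum => i _; rewrite !sum1_card h.
Qed.

End Factorization.

(** * Uniqueness of roots *)

Section Root.
Set Implicit Arguments.
Unset Strict Implicit.

Lemma card_tagged_fiber (I S : finType) (T : I -> finType)
    (t : forall i, T i -> S) (x : S) :
  #|[pred u : {i : I & T i} | t (tag u) (tagged u) == x]| =
  \sum_i #|[pred v : T i | t i v == x]|.
Proof.
rewrite -sum1_card; under [RHS]eq_bigr do rewrite -sum1_card.
by rewrite (sig_big_dep (fun=> true) (fun i v => t i v == x) (fun _ _ => 1%N)).
Qed.

Lemma card_tag_fiber (S : finType) (n : S -> nat) (i : S) :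
  #|[pred u : {i : S & 'I_(n i)} | tag u == i]| = n i.
Proof.
rewrite (card_tagged_fiber (fun j (_ : 'I_(n j)) => j)) (bigD1 i) //=.
rewrite big1 => [|j ji].
  by rewrite addn0 -[RHS]card_ord; apply: eq_card => v; rewrite !inE eqxx.
by apply: eq_card0 => v; rewrite inE; exact: negbTE.
Qed.

(** Charting each copy of [Q] in [Q^k] by the same prime factors yields a second
    prime chart of [X].  Unique factorization preserves the isometry types, so
    [Q] has [m i %/ k] factors of type [A i], exactly as [P] has. *)
Lemma root_unique (R : realType) (X : metricType R) (r : R)
    (hX : connected_thin X r) (x0 : X)
    (s : nat) (A : 'I_s -> metricType R) (m : 'I_s -> nat)
    (A_noniso : forall i j : 'I_s, i <> j -> ~ isometric (A i) (A j))
    (A_prime : forall i : 'I_s, linf_prime (A i))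
    (X_factors : isometric X (linf_prod (fun i => linf_pow (A i) (m i))))
    (k : nat) (k_gt0 : (0 < k)%N) (P Q : metricType R)
    (P_factors : isometric P (linf_prod (fun i => linf_pow (A i) (m i %/ k)%N)))
    (q : 'I_k -> X -> Q) :
  @product_chart R X _ (fun=> Q) q -> isometric P Q.
Proof.
move=> hq.
have pow_chart n i :
    product_chart (fun (t : 'I_(n i)) (p : linf_pow (A i) (n i)) => p t).
  split=> [p|x y a a0]; first by exists p.
  exact: linf_dist_le.
have flat Y n : isometric Y (linf_prod (fun i => linf_pow (A i) (n i))) ->
    exists c : forall u : {i : 'I_s & 'I_(n i)}, Y -> A (tag u), product_chart c.
  case=> h; have := chart_sigma (iso_chart h) (pow_chart n).
  by move=> hc; eexists; exact: hc.
have [c hc] := flat _ _ X_factors.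
have [sg hsg] := prime_lines hX x0 hc (fun u => A_prime (tag u)) hq.
(* Any index would do: the block of j0 provides the prime factors of Q. *)
pose j0 : 'I_k := Ordinal k_gt0.
have [e he] := block_chart x0 hc hq hsg j0.
have hce := chart_sigma hq (fun=> he).
have [rho rho_bij rho_iso] := unique_factorization hX x0
  hc (fun u => A_prime (tag u)) hce (fun u => A_prime _).
have rho_tag u : tag (val (tagged (rho u))) = tag u.
  by apply: contrapT => /nesym/A_noniso; apply; exact: rho_iso.
have cnt i : #|[pred b : {b | sg b == j0} | tag (val b) == i]| = (m i %/ k)%N.
  rewrite -(card_tag_fiber m i) -(mulKn #|[pred b | tag (val b) == i]| k_gt0).
  congr (_ %/ k)%N.
  have := card_tagged_fiber (fun (_ : 'I_k) (b : {b | sg b == j0}) => tag (val b)) i.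
  rewrite sum_nat_const card_ord => <-.
  rewrite -!sum1_card (reindex rho) /=; last exact: onW_bij.
  by apply: eq_bigl => u; rewrite !inE rho_tag.
have [f f_bij f_tag] : exists2 f : {i : 'I_s & 'I_(m i %/ k)} -> {b | sg b == j0},
    bijective f & forall u, tag (val (f u)) = tag u.
  apply: (@equal_fibers_bij _ _ _ tag (fun b => tag (val b))) => i.
  by rewrite cnt card_tag_fiber.
have f_iso u : isometric (A (tag (val (f u)))) (A (tag u)).
  by rewrite f_tag; constructor; exists id; split=> //; exists id.
have [d hd] := chart_reindex he f_bij f_iso.
have [d' hd'] := flat _ _ P_factors.
exact: chart_isometric hd' hd.
Qed.

End Root.

(** * Power structures as isometries with a power *)

Section Structures.
Local Notation coord := Defs.coord.
Set Implicit Arguments.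
Unset Strict Implicit.
Import Order.TTheory GRing.Theory Num.Theory.
Local Open Scope ring_scope.
Local Open Scope quotient_scope.
Local Open Scope classical_set_scope.
Context (R : realType).

Lemma metric_iso_ext (X Y : metricType R) (f g : metric_iso X Y) :
  f =1 g -> f = g.
Proof.
case: f g => [f hf] [g hg] /= /funext e; move: hf; rewrite e => hf.
by congr MetricIso; exact: Prop_irrelevance.
Qed.

(** Turns a quotient with its quotient distance into a space of its own. *)
Definition metric_carrier (T : Type) (d : T -> T -> R) (hd : is_metric d) :
  Type := T.

Section MetricCarrier.
Context (T : Type) (d : T -> T -> R) (hd : is_metric d).
HB.instance Definition _ := gen_eqMixin (metric_carrier hd).
HB.instance Definition _ := gen_choiceMixin (metric_carrier hd).
Let cxx (x : metric_carrier hd) : d x x = 0.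
Proof. by have [_ h _ _] := hd; apply/h. Qed.
Let cpos (x y : metric_carrier hd) : d x y = 0 -> x = y.
Proof. by have [_ h _ _] := hd; move/h. Qed.
Let csym (x y : metric_carrier hd) : d x y = d y x.
Proof. by have [] := hd. Qed.
Let ctri (y x z : metric_carrier hd) : d x z <= d x y + d y z.
Proof. by have [] := hd. Qed.
HB.instance Definition _ := 
  @isMetric.Build R (metric_carrier hd) d cxx cpos csym ctri.
End MetricCarrier.

Section PowData.
Context (X : metricType R) (k : nat) (hk : (1 < k)%N).

Lemma equiv_rel_ext (E F : equiv_rel X) : (forall x y, E x y = F x y) -> E = F.
Proof.
case: E F => [E hE] [F hF] /= h.
have e : E = F by apply: funext => x; apply: funext => y; exact: h.
move: hE; rewrite e => hE; congr EquivRelPack.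
case: hE hF => a b c [a' b' c'].
by congr EquivClass; exact: Prop_irrelevance.
Qed.

Local Notation tau S hj := (@pow_tau R X k hk S _ hj).

(** The quotient types depend on the relations, so the gluing maps of two
    structures are compared through their graphs on points of [X]. *)
Lemma pow_data_ext (S S' : pow_data X hk) :
  (forall j x y, pow_rel S j x y = pow_rel S' j x y) ->
  (forall (j : 'I_k) (hj : (0 < j)%N) x y,
     tau S hj (\pi_{eq_quot (pow_rel S j)} x) =
       \pi_{eq_quot (pow_rel S (ord_first hk))} y <->
     tau S' hj (\pi_{eq_quot (pow_rel S' j)} x) =
       \pi_{eq_quot (pow_rel S' (ord_first hk))} y) -> S = S'.
Proof.
case: S S' => [E t] [E' t'] /= hE.
have e : E = E'.
  by apply: functional_extensionality_dep => j; apply: equiv_rel_ext; exact: hE.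
move: t; rewrite e => t ht; congr PowData.
apply: functional_extensionality_dep => j.
apply: functional_extensionality_dep => hj.
apply: functional_extensionality_dep => C; apply: esym.
have := ht j hj (repr C) (repr (t j hj C)); rewrite !reprK => -[h _].
exact: h.
Qed.

(** An equality of structures is only ever used through these two families of
    equivalences, which avoid transporting the gluing maps. *)
Lemma pow_data_relE (S S' : pow_data X hk) : S = S' ->
  (forall j x y, pow_rel S j x y = pow_rel S' j x y) /\
  (forall (j : 'I_k) (hj : (0 < j)%N) x y,
     tau S hj (\pi_{eq_quot (pow_rel S j)} x) =
       \pi_{eq_quot (pow_rel S (ord_first hk))} y <->
     tau S' hj (\pi_{eq_quot (pow_rel S' j)} x) =
       \pi_{eq_quot (pow_rel S' (ord_first hk))} y).
Proof. by move=> ->. Qed.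

Lemma ord_firstP (j : 'I_k) : ~~ (0 < j)%N -> j = ord_first hk.
Proof. by rewrite -leqNgt leqn0 => /eqP j0; apply: val_inj. Qed.

Section Coordinates.
Context (P : metricType R) (phi : metric_iso (linf_pow P k) X).

Lemma coord_chart : product_chart (coord phi : forall j : 'I_k, X -> P).
Proof. exact: (iso_chart (iso_inv phi)). Qed.

Lemma coordK j p : coord phi j (phi p) = p j.
Proof. by rewrite /coord /pow_proj /= /iso_inv_fun bij_invK. Qed.

Lemma coord_tauE (j : 'I_k) (hj : (0 < j)%N) x y :
  tau (factor_str hk phi) hj (\pi_{eq_quot (coord_equiv phi j)} x) =
    \pi_{eq_quot (coord_equiv phi (ord_first hk))} y <->
  coord phi j x = coord phi (ord_first hk) y.
Proof.
rewrite /= /factor_tau /= coord_bar_pi -(coord_bar_pi phi (ord_first hk)).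
split=> [<-|->]; last exact: bij_invK.
by rewrite bij_invKV.
Qed.

(** Two points of a power of [P] with constant coordinates realize the infimum,
    and no pair of points of the two classes is closer. *)
Lemma quot_dist_coord j (C C' : {eq_quot (coord_equiv phi j)}) :
  quot_dist C C' = mdist (coord_bar C) (coord_bar C').
Proof.
have hc := coord_chart.
have fib (x : X) (D : {eq_quot (coord_equiv phi j)}) :
    quot_fiber D x <-> coord phi j x = coord_bar D.
  split=> [<-|h]; first by rewrite coord_bar_pi.
  by apply: (bij_inj (coord_bar_bij phi j)); rewrite coord_bar_pi.
apply: le_anti; apply/andP; split.
  have [x hx] : exists x, forall i, coord phi i x = coord_bar C.
    by have [x hx] := proj1 hc (fun=> coord_bar C); exists x.
  have [y hy] : exists y, forall i, coord phi i y = coord_bar C'.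
    by have [y hy] := proj1 hc (fun=> coord_bar C'); exists y.
  apply: le_trans (_ : mdist x y <= _).
    apply: ge_inf; first by exists 0 => _ [u _ [v _ <-]]; exact: mdist_ge0.
    by exists x; [exact/fib|exists y; [exact/fib|]].
  apply/(proj2 hc) => [|i]; first exact: mdist_ge0.
  by rewrite hx hy.
apply: lb_le_inf.
  exists (mdist (repr C) (repr C')); exists (repr C); first exact/fib.
  by exists (repr C'); first exact/fib.
move=> _ [x /fib <- [y /fib <- <-]].
by apply: (proj1 (proj2 hc x y _ (mdist_ge0 x y))).
Qed.

Lemma factor_str_pow : is_pow_str (factor_str hk phi).
Proof.
have hc := coord_chart.
split=> [j|C|x y|j hj].
- have b := coord_bar_bij phi j.
  split=> [C C'|C C'|C C'|C C' C'']; rewrite /= !quot_dist_coord.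
  + exact: mdist_ge0.
  + split=> [/mdist_positivity/(bij_inj b)//|->]; exact: mdistxx.
  + exact: metric_sym.
  + exact: metric_triangle.
- have [x hx] := proj1 hc (fun j => coord_bar (C j)).
  exists x; apply/seteqP; split=> [y hy|_ -> j _] /=.
    apply: (chart_inj hc) => j; rewrite hx.
    by rewrite -(hy j I) coord_bar_pi.
  apply: (bij_inj (coord_bar_bij phi j)).
  by rewrite coord_bar_pi hx.
- apply: bigmax_of_le => [|a a0]; first exact: mdist_ge0.
  rewrite (proj2 hc) //; split=> h j; have := h j;
    by rewrite /= quot_dist_coord !coord_bar_pi.
split.
  apply: bij_comp (coord_bar_bij phi j).
  by exists (@coord_bar _ _ _ _ phi (ord_first hk));
    [exact: bij_invKV|exact: bij_invK].
by move=> C C'; rewrite /= !quot_dist_coord /factor_tau /= !bij_invKV.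
Qed.

End Coordinates.

(** The value [f p] is read off at the image under [phi] of the diagonal point
    of [p]: every coordinate equal to [p] can be compared to the first
    coordinate of that point, through [tau_j] or through [E_1]. *)
Lemma factor_str_eqP (P : metricType R) (phi psi : metric_iso (linf_pow P k) X) :
  factor_str hk phi = factor_str hk psi <->
  exists f : metric_iso P P, forall j x, coord psi j x = f (coord phi j x).
Proof.
split=> [/pow_data_relE[hrel htau]|[f hf]]; last first.
  apply: pow_data_ext => [j x y|j hj x y].
    rewrite /= /coord_rel !hf; apply/eqP/eqP => [->//|].
    exact: (bij_inj (proj1 (isoP f))).
  rewrite !coord_tauE !hf; split=> [->//|].
  exact: (bij_inj (proj1 (isoP f))).
have key j x y : coord phi j x = coord phi (ord_first hk) y <->
                 coord psi j x = coord psi (ord_first hk) y.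
  have [hj|/ord_firstP ->] := boolP (0 < j)%N.
    by rewrite -!(coord_tauE _ hj); exact: htau.
  have := hrel (ord_first hk) x y; rewrite /= /coord_rel => e.
  by split=> /eqP; [rewrite e|rewrite -e] => /eqP.
pose f (p : P) := coord psi (ord_first hk) (phi (fun=> p)).
pose f' (p : P) := coord phi (ord_first hk) (psi (fun=> p)).
have hf j x : coord psi j x = f (coord phi j x).
  by apply/key; rewrite coordK.
have hf' j x : coord phi j x = f' (coord psi j x).
  by apply/key; rewrite coordK.
have fP : is_isometry mdist mdist f.
  split.
    exists f' => p.
      by rewrite /f -hf' coordK.
    by rewrite /f' -hf coordK.
  move=> p p'; pose y := phi (fun=> p); pose y' := phi (fun=> p').
  apply: eq_of_le; rewrite ?mdist_ge0 // => a a0.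
  have h1 := proj2 (coord_chart phi) y y' a a0.
  have h2 := proj2 (coord_chart psi) y y' a a0.
  split=> h.
    have /h2/h1/(_ (ord_first hk)) :
        forall i, mdist (coord psi i y) (coord psi i y') <= a.
      by move=> i; rewrite !hf !coordK.
    by rewrite !coordK.
  have /h1/h2/(_ (ord_first hk)) :
        forall i, mdist (coord phi i y) (coord phi i y') <= a.
    by move=> i; rewrite !coordK.
  by rewrite !hf !coordK.
by exists (MetricIso fP).
Qed.

Section OfStructure.
Context (S : pow_data X hk) (hS : is_pow_str S).

(** The gluing map [tau_1], which the data leave out, is the identity; adding it
    treats all indices alike. *)
Lemma pow_str_maps j :
  exists t : {eq_quot (pow_rel S j)} -> {eq_quot (pow_rel S (ord_first hk))},
    [/\ is_isometry (@quot_dist R X (pow_rel S j)) (@quot_dist R X _) t,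
        forall hj : (0 < j)%N, t = tau S hj &
        j = ord_first hk -> forall x, t (\pi x) = \pi x].
Proof.
have [_ _ _ ht] := hS.
have [hj|nj] : (0 < j)%N \/ ~~ (0 < j)%N by apply/orP; rewrite orbN.
  exists (tau S hj); split=> [|hj'|e]; first exact: ht.
    by rewrite (bool_irrelevance hj hj').
  by move: hj; rewrite e.
rewrite (ord_firstP nj).
by exists id; split=> //; split=> //; exists id.
Qed.

Definition pow_root : metricType R :=
  metric_carrier (let: And4 h _ _ _ := hS in h (ord_first hk)).

(** The j-th coordinate is the class for [E_j], carried to [X / E_1] by [tau_j].
    The axioms on intersections of classes and on distances say that this is a
    product chart. *)
Lemma pow_str_chart : exists q : 'I_k -> X -> pow_root,
  [/\ product_chart (q : forall j : 'I_k, X -> pow_root),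
      forall j x y, pow_rel S j x y = (q j x == q j y) &
      forall (j : 'I_k) (hj : (0 < j)%N) x y,
        tau S hj (\pi_{eq_quot (pow_rel S j)} x) =
          \pi_{eq_quot (pow_rel S (ord_first hk))} y <->
        q j x = q (ord_first hk) y].
Proof.
have [_ h2 h3 _] := hS.
pose t j := sval (cid (pow_str_maps j)).
have t_iso j : is_isometry (@quot_dist R X (pow_rel S j)) (@quot_dist R X _) (t j).
  by rewrite /t; case: cid => ? [].
have tE (j : 'I_k) (hj : (0 < j)%N) : t j = tau S hj.
  by rewrite /t; case: cid => ? [].
have t0 x : t (ord_first hk) (\pi x) = \pi x.
  have [_ _ h] := proj2_sig (cid (pow_str_maps (ord_first hk))).
  exact: h.
exists (fun j x => t j (\pi x)); split=> [|j x y|j hj x y].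
- split=> [p|x y a a0].
    have [x hx] := h2 (fun j => bij_inv (proj1 (t_iso j)) (p j)).
    exists x => j.
    have : [set x] x by [].
    by rewrite -hx => /(_ j I) /= ->; rewrite bij_invKV.
  rewrite h3; split=> [/bigmax_leP[_ h] j|h].
    by rewrite [mdist _ _](proj2 (t_iso j)); exact: h.
  apply/bigmax_leP; split=> // j _.
  by rewrite -(proj2 (t_iso j)); exact: h.
- rewrite -eqmodE; apply/eqP/eqP => [->//|].
  exact: (bij_inj (proj1 (t_iso j))).
by rewrite t0 (tE j hj).
Qed.

End OfStructure.

(** The isometry [h] renames the root from [Q] to [P]. *)
Lemma iso_of_chart (P Q : metricType R) (h : metric_iso P Q) (q : 'I_k -> X -> Q) :
  product_chart (q : forall j : 'I_k, X -> Q) ->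
  exists phi : metric_iso (linf_pow P k) X, forall j x, h (coord phi j x) = q j x.
Proof.
move=> hq.
pose f (p : linf_pow P k) := sval (cid (proj1 hq (fun j => h (p j)))).
have fE p j : q j (f p) = h (p j) by rewrite /f; case: cid => z /= ->.
pose g x : linf_pow P k := fun j => iso_inv h (q j x).
have hg j x : h (g x j) = q j x by rewrite /g /= /iso_inv_fun bij_invKV.
have gK : cancel g f.
  by move=> x; apply: (chart_inj hq) => j; rewrite fE hg.
have fP : is_isometry mdist mdist f.
  split.
    exists g => // p; apply: functional_extensionality_dep => j.
    by apply: (bij_inj (proj1 (isoP h))); rewrite hg fE.
  move=> p p'; apply: eq_of_le; rewrite ?mdist_ge0 // => a a0.
  have e : mdist p p' <= a <-> forall j, mdist (p j) (p' j) <= a.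
    exact: linf_dist_le.
  rewrite (proj2 hq) // e.
  by split=> H j; have := H j; rewrite !fE (proj2 (isoP h)).
exists (MetricIso fP) => j x.
by rewrite -[x in RHS](gK x) fE /= -[x in LHS](gK x) coordK.
Qed.

End PowData.
End Structures.

(** * The bijection with cosets *)

Lemma eq_lcosetP (R : realType) (k : nat) (P X : metricType R)
    (phi0 : metric_iso (linf_pow P k) X) (g g' : metric_iso X X) :
  iso_lcoset (diag_subgroup phi0) g = iso_lcoset (diag_subgroup phi0) g' <->
  exists f : metric_iso P P, forall p, g (phi0 p) = g' (phi0 (pow_map f p)).
Proof.
pose D f := iso_comp phi0 (iso_comp (pow_iso k f) (iso_inv phi0)).
have mem g1 g2 : iso_lcoset (diag_subgroup phi0) g2 g1 <->
    exists f : metric_iso P P, forall p, g1 (phi0 p) = g2 (phi0 (pow_map f p)).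
  split=> [[_ [f _ <-] <-]|[f hf]].
    by exists f => p; rewrite /= /iso_inv_fun bij_invK.
  exists (D f); first by exists f.
  apply: metric_iso_ext => x.
  by rewrite /= -hf /iso_inv_fun bij_invKV.
have idP : is_isometry (@mdist R P) mdist id by split=> //; exists id.
split=> [e|[f hf]].
  by apply/mem; rewrite -e; apply/mem; exists (MetricIso idP).
apply/seteqP; split=> h /mem [f1 hf1]; apply/mem.
  by exists (iso_comp f f1) => p; rewrite hf1 hf.
exists (iso_comp (iso_inv f) f1) => p; rewrite hf1 hf; congr (g' (phi0 _)).
apply: functional_extensionality_dep => j.
by rewrite /pow_map /= /iso_inv_fun bij_invKV.
Qed.

Theorem theorem4p67 (R : realType) (X : metricType R)
  (X_nonempty : inhabited X)
  (D_finite : finite_set (distance_set X))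
  (X_threshold : exists r : R, [/\ distance_set X r,
     connected_over (@threshold R X r) & separating_over (@threshold R X r)])
  (s : nat) (s_ge1 : (1 <= s)%N)
  (A : 'I_s -> metricType R) (m : 'I_s -> nat)
  (A_noniso : forall i j : 'I_s, i <> j -> ~ isometric (A i) (A j))
  (A_prime : forall i : 'I_s, linf_prime (A i))
  (m_ge1 : forall i : 'I_s, (1 <= m i)%N)
  (X_factors : isometric X (linf_prod (fun i : 'I_s => linf_pow (A i) (m i))))
  (k : nat) (k_ge2 : (1 < k)%N) (k_dvd : forall i : 'I_s, (k %| m i)%N)
  (rootX : metricType R)
  (rootX_factors :
     isometric rootX (linf_prod (fun i : 'I_s => linf_pow (A i) (m i %/ k)%N)))
  (phi0 : metric_iso (linf_pow rootX k) X) :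
  exists Phi : iso_quot (diag_subgroup phi0) -> PowStr X k_ge2,
    (forall g : metric_iso X X,
       sval (Phi (iso_class (diag_subgroup phi0) g)) =
       factor_str k_ge2 (iso_comp g phi0)) /\
    bijective Phi.
Proof.
have [x0] := X_nonempty.
have {X_threshold} [r hX] : exists r, connected_thin X r.
  have [r [[[x y] _ /= <-] hc hs]] := X_threshold.
  by exists (mdist x y); split=> //; exact: mdist_ge0.
have cosetP g g' :
    iso_lcoset (diag_subgroup phi0) g = iso_lcoset (diag_subgroup phi0) g' <->
    factor_str k_ge2 (iso_comp g phi0) = factor_str k_ge2 (iso_comp g' phi0).
  rewrite eq_lcosetP factor_str_eqP; split=> -[f hf]; exists f.
    move=> j x; pose p := iso_inv (iso_comp g phi0) x.
    have e1 : x = iso_comp g phi0 p.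
      exact: (esym (bij_invKV (proj1 (isoP (iso_comp g phi0))) x)).
    have e2 : x = iso_comp g' phi0 (pow_map f p) by rewrite e1 /= hf.
    by rewrite {1}e2 coordK {1}e1 coordK.
  move=> p; apply: (chart_inj (coord_chart (iso_comp g' phi0))) => j.
  rewrite hf -[g (phi0 p)]/(iso_comp g phi0 p) coordK.
  by rewrite -[g' _]/(iso_comp g' phi0 (pow_map f p)) coordK.
pose rep (C : iso_quot (diag_subgroup phi0)) := sval (cid (proj2_sig C)).
have repE C : sval C = iso_lcoset (diag_subgroup phi0) (rep C).
  by rewrite /rep; case: cid.
pose Phi C : PowStr X k_ge2 :=
  exist _ _ (factor_str_pow k_ge2 (iso_comp (rep C) phi0)).
have PhiE g : sval (Phi (iso_class (diag_subgroup phi0) g)) =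
    factor_str k_ge2 (iso_comp g phi0).
  by apply/cosetP; rewrite -repE.
have Phi_inj : injective Phi.
  move=> C C' /(congr1 sval) /= /cosetP e; apply: sval_inj.
  by rewrite !repE e.
have Phi_surj S : exists C, Phi C = S.
  case: S => S hS.
  have [q [hq qrel qtau]] := pow_str_chart hS.
  have [h] : isometric rootX (pow_root hS).
    exact: (root_unique hX x0 A_noniso A_prime X_factors (ltnW k_ge2)
      rootX_factors hq).
  have [phi hphi] := iso_of_chart h hq.
  have hinj := bij_inj (proj1 (isoP h)).
  (* The isometry that carries phi0 to phi. *)
  exists (iso_class (diag_subgroup phi0) (iso_comp phi (iso_inv phi0))).
  apply: sval_inj.
  rewrite PhiE /=.
  have -> : iso_comp (iso_comp phi (iso_inv phi0)) phi0 = phi.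
    by apply: metric_iso_ext => p; rewrite /= /iso_inv_fun bij_invK.
  apply: pow_data_ext => [j x y|j hj x y].
    by rewrite qrel /= /coord_rel -!hphi (inj_eq hinj).
  rewrite coord_tauE qtau -!hphi; split=> [->//|]; exact: hinj.
exists Phi; split=> //.
have [Psi PsiK] := choice Phi_surj.
by exists Psi => // C; apply: Phi_inj; rewrite PsiK.
Qed.
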